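(* Let $G$ be an infinite discrete group. Then: (i) The Bernoulli flow $2^G$ is disjoint from every minimal $G$-flow. (ii) $\mathfrak{A}(G) \neq \ell^\infty(G)$.
   Context: A $G$-flow is a compact Hausdorff space with an action of $G$ by homeomorphisms. A $G$-flow is minimal if every orbit is dense. The Bernoulli flow is $2^G=\{0,1\}^G$ with the action $(g\cdot z)(h)=z(hg)$. Two $G$-flows $X,Y$ are disjoint if the only closed $G$-invariant subset of $X\times Y$ (with the diagonal action) that projects onto both $X$ and $Y$ is $X\times Y$ itself. A function $\phi\in\ell^\infty(G)$ is called minimal if there exist a minimal $G$-flow $X$, a point $x_0\in X$ and $f\in C(X)$ with $\phi(g)=f(g\cdot x_0)$ for all $g\in G$; $\mathfrak{A}(G)$ denotes the norm-closed subalgebra of $\ell^\infty(G)$ generated by all minimal functions. *)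

(* Defs.v *)
From Stdlib Require Import Reals List.
Open Scope R_scope.

Record Group := {
  gcar :> Type;
  gmul : gcar -> gcar -> gcar;
  gone : gcar;
  ginv : gcar -> gcar;
  gmul_assoc : forall a b c, gmul a (gmul b c) = gmul (gmul a b) c;
  gmul_1l : forall a, gmul gone a = a;
  gmul_Vl : forall a, gmul (ginv a) a = gone
}.

Definition infinite_group (G : Group) : Prop :=
  ~ exists l : list (gcar G), forall g, In g l.

Definition compact {T : Type} (op : (T -> Prop) -> Prop) : Prop :=
  forall F : (T -> Prop) -> Prop,
    (forall U, F U -> op U) ->
    (forall x, exists U, F U /\ U x) ->
    exists l : list (T -> Prop),
      (forall U, In U l -> F U) /\ (forall x, exists U, In U l /\ U x).

Definition hausdorff {T : Type} (op : (T -> Prop) -> Prop) : Prop :=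
  forall x y : T, x <> y ->
    exists U V, op U /\ op V /\ U x /\ V y /\ (forall z, ~ (U z /\ V z)).

Definition closed_set {T : Type} (op : (T -> Prop) -> Prop) (C : T -> Prop) : Prop :=
  op (fun x => ~ C x).

Definition prod_open {X Y : Type} (opX : (X -> Prop) -> Prop)
  (opY : (Y -> Prop) -> Prop) (W : X * Y -> Prop) : Prop :=
  forall p, W p -> exists A B, opX A /\ opY B /\ A (fst p) /\ B (snd p) /\
    (forall x y, A x -> B y -> W (x, y)).

Definition continuous_R {T : Type} (op : (T -> Prop) -> Prop) (f : T -> R) : Prop :=
  forall x eps, 0 < eps ->
    exists U, op U /\ U x /\ forall y, U y -> Rabs (f y - f x) < eps.

Record Flow (G : Group) := {
  fpt : Type;
  fopen : (fpt -> Prop) -> Prop;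
  fopen_full : fopen (fun _ => True);
  fopen_inter : forall U V, fopen U -> fopen V -> fopen (fun x => U x /\ V x);
  fopen_union : forall F : (fpt -> Prop) -> Prop,
      (forall U, F U -> fopen U) -> fopen (fun x => exists U, F U /\ U x);
  fcompact : compact fopen;
  fhausdorff : hausdorff fopen;
  fact : gcar G -> fpt -> fpt;
  fact_cont : forall g U, fopen U -> fopen (fun x => U (fact g x));
  fact_one : forall x, fact (gone G) x = x;
  fact_mul : forall g h x, fact (gmul G g h) x = fact g (fact h x)
}.

Arguments fpt {G}.
Arguments fopen {G}.
Arguments fact {G}.

Definition minimal_flow {G : Group} (X : Flow G) : Prop :=
  forall (x : fpt X) (U : fpt X -> Prop), fopen X U -> (exists y, U y) ->
    exists g, U (fact X g x).

Definition disjoint_flows {G : Group} {X Y : Type}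
  (opX : (X -> Prop) -> Prop) (actX : gcar G -> X -> X)
  (opY : (Y -> Prop) -> Prop) (actY : gcar G -> Y -> Y) : Prop :=
  forall C : X * Y -> Prop,
    closed_set (prod_open opX opY) C ->
    (forall g x y, C (x, y) -> C (actX g x, actY g y)) ->
    (forall x, exists y, C (x, y)) ->
    (forall y, exists x, C (x, y)) ->
    forall p, C p.

(* Bernoulli flow 2^G = {0,1}^G with product topology and (g.z)(h) = z(hg). *)
Definition bern_open (G : Group) (U : (gcar G -> bool) -> Prop) : Prop :=
  forall z, U z -> exists l : list (gcar G),
    forall z', (forall h, In h l -> z' h = z h) -> U z'.

Definition bern_act (G : Group) (g : gcar G) (z : gcar G -> bool) : gcar G -> bool :=
  fun h => z (gmul G h g).

Definition bounded_fun {G : Group} (phi : gcar G -> R) : Prop :=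
  exists M, forall g, Rabs (phi g) <= M.

Definition minimal_function {G : Group} (phi : gcar G -> R) : Prop :=
  exists (X : Flow G) (x0 : fpt X) (f : fpt X -> R),
    minimal_flow X /\ continuous_R (fopen X) f /\
    forall g, phi g = f (fact X g x0).

Definition norm_closed_subalgebra {G : Group} (S : (gcar G -> R) -> Prop) : Prop :=
  (forall phi, S phi -> bounded_fun phi) /\
  (forall phi psi, S phi -> S psi -> S (fun g => phi g + psi g)) /\
  (forall phi psi, S phi -> S psi -> S (fun g => phi g * psi g)) /\
  (forall c phi, S phi -> S (fun g => c * phi g)) /\
  (forall phi, (forall eps, 0 < eps -> exists psi, S psi /\
                   forall g, Rabs (phi g - psi g) <= eps) -> S phi).

Definition frakA (G : Group) (phi : gcar G -> R) : Prop :=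
  forall S : (gcar G -> R) -> Prop,
    norm_closed_subalgebra S ->
    (forall psi, minimal_function psi -> S psi) ->
    S phi.

(* Main.v *)
(** For (i), let [U] be a nonempty open subset of a minimal flow [X], [x0] a point of [U] and
[alpha] a pattern on a finite set [E] of group elements. The return times of [x0] to [U] form an infinite
set, so it contains arbitrarily large finite sets [R] for which the sets [E r], [r] in [R], are
disjoint. By the Lovasz local lemma, given a finite set [F] there is a function [z] on [G] such that
for every [h] in [F] the pattern [alpha] occurs in [z] on one of the sets [E r h]. By minimality and
compactness [F] can be chosen such that every [x] is moved by some [h] in [F] so close to [x0] that
[r h x] lies in [U] for all [r] in [R]. So for every [x] there is [g] with [g x] in [U] and [g z]
equal to [alpha] on [E], which is disjointness.

For (ii), every element of the algebra is uniformly continuous with respect to finitely many minimal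
functions [psi_1, ..., psi_n]. Take [chi : G -> {0,1}] whose translates realise all finite patterns.
If [chi] depended only on the approximate values of the [psi_i], apply the pattern statement above
to the flows of [psi_n, ..., psi_1] in turn: it allows one to prescribe the pattern as a function of
the values of the [psi_i], in particular as the opposite of what these values impose on [chi]. *)

From Stdlib Require Import Reals List Lra Inverse_Image.
From mathcomp Require Import all_boot boolp zify.
Require Import Defs.

Set Implicit Arguments.
Unset Strict Implicit.
Unset Printing Implicit Defensive.
Local Open Scope nat_scope.

(** * Local lemma *)

Section LocalLemma.
Variables (Omega I : finType) (A : I -> {set Omega}) (N : I -> {set I}) (D : nat).
Hypotheses (Omega_gt0 : 0 < #|Omega|) (D_gt0 : 0 < D).
Let good (S : {set I}) : {set Omega} := \bigcap_(i in S) ~: A i.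
Hypothesis card_N : forall i, #|N i| <= D.
(** Probabilities are counts with denominators cleared: given that no event of [S] occurs, [A i] has
    conditional probability at most 1/(4D). Only this consequence of independence enters. *)
Hypothesis A_rare : forall (i : I) (S : {set I}), [disjoint S & N i] ->
  4 * D * #|good S :&: A i| <= #|good S|.

Let goodU i (S : {set I}) : good (i |: S) = good S :\: A i.
Proof.
apply/setP=> w; rewrite !inE; apply/bigcapP/andP => [H|[Hi /bigcapP H] j].
  split; first by have := H i; rewrite !inE eqxx => /(_ isT).
  by apply/bigcapP=> j jS; apply: H; rewrite !inE jS orbT.
by rewrite !inE => /orP[/eqP->|/H] //; rewrite inE.
Qed.

Let good_sub (S S' : {set I}) : S' \subset S -> good S \subset good S'.
Proof.
move=> /subsetP sS; apply/subsetP=> w /bigcapP H; apply/bigcapP=> i /sS; exact: H.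
Qed.

(* The conditional probability of [A i] given that no event of [S] occurs is at most [1/(2 D)]. *)
Let cond_rare (S : {set I}) i : 2 * D * #|good S :&: A i| <= #|good S|.
Proof.
elim: {S}#|S| {-2}S (leqnn #|S|) i => [|n IH] S.
  rewrite leqn0 cards_eq0 => /eqP-> i; have := @A_rare i set0.
  rewrite disjoints_subset sub0set => /(_ isT); lia.
move=> Sn i; have [dis|ndis] := boolP [disjoint S & N i].
  by have := A_rare dis; lia.
set S' := S :\: N i.
have S'n : #|S'| <= n.
  have : S' \proper S.
    rewrite properE subsetDl /=; apply: contra ndis => /subsetP sSS'.
    rewrite disjoints_subset; apply/subsetP=> j /sSS'; rewrite !inE.
    by case/andP.
  by move/proper_card; lia.
have rare' : 4 * D * #|good S' :&: A i| <= #|good S'|.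
  apply: A_rare; rewrite disjoints_subset; apply/subsetP=> j; rewrite !inE.
  by case/andP.
have sub1 : good S :&: A i \subset good S' :&: A i.
  by apply: setSI; apply/good_sub/subsetDl.
have := subset_leq_card sub1 => le1.
(* At most [D] events of [N i] separate [good S'] from [good S], each of conditional probability at
   most 1/(2D) by induction. So [good S] keeps half of [good S'], and the bound 1/(4D) at most
   doubles. *)
have cover : good S' \subset good S :|: \bigcup_(j in N i) (good S' :&: A j).
  apply/subsetP=> w wS'; rewrite inE.
  have [//|/= wS] := boolP (w \in good S).
  apply/bigcupP; have : ~~ [forall (j | j \in S), w \notin A j].
    apply: contra wS => /forall_inP H; apply/bigcapP=> j /H; by rewrite inE.
  case/forall_inPn=> j jS; rewrite negbK => wA.
  exists j; last by rewrite inE wS'.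
  apply/idPn => jN; move/bigcapP: wS' => /(_ j).
  by rewrite !inE jS jN wA => /(_ isT).
have le2 : 2 * D * #|\bigcup_(j in N i) (good S' :&: A j)| <= D * #|good S'|.
  apply: leq_trans (_ : \sum_(j in N i) 2 * D * #|good S' :&: A j| <= _).
    elim/big_rec2: _ => [|j x y _ le]; first by rewrite cards0 muln0.
    have := leq_of_leqif (leq_card_setU (good S' :&: A j) y).
    by rewrite -(leq_pmul2l (m := 2 * D)); [lia | rewrite muln_gt0].
  apply: leq_trans (_ : \sum_(j in N i) #|good S'| <= _).
    by apply: leq_sum => j _; apply: IH.
  by rewrite sum_nat_const leq_mul2r card_N orbT.
have le3 := leq_trans (subset_leq_card cover) (leq_card_setU _ _).
nia.
Qed.

(** Events are added one at a time; by [cond_rare] each removes at most half of a nonempty set. *)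
Lemma local_lemma : exists w, forall i, w \notin A i.
Proof.
have pos (S : {set I}) : 0 < #|good S|.
  elim: {S}#|S| {-2}S (leqnn #|S|) => [|n IH] S.
    rewrite leqn0 cards_eq0 => /eqP->.
    by rewrite /good big_set0 cardsT.
  case: (set_0Vmem S) => [->|[i iS]] Sn; first by rewrite /good big_set0 cardsT.
  have := IH (S :\ i).
  have -> : #|S :\ i| <= n by move: Sn; rewrite (cardsD1 i) iS; lia.
  move/(_ isT) => pos1; rewrite -(setD1K iS) goodU.
  have := cond_rare (S :\ i) i; have := cardsID (A i) (good (S :\ i)).
  nia.
have /card_gt0P[w /bigcapP H] := pos setT; exists w => i.
by have := H i; rewrite !inE => /(_ isT).
Qed.
End LocalLemma.

(** * Independence of events on disjoint coordinates *)

Section Independence.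
Variables V K : finType.
Implicit Types (f g : {ffun V -> K}) (A B : {set {ffun V -> K}}) (U : {set V}).

Definition depends_on U A := forall f g, {in U, f =1 g} -> (f \in A) = (g \in A).

Lemma depends_onS U U' A : U \subset U' -> depends_on U A -> depends_on U' A.
Proof. by move=> /subsetP sU dA f g fg; apply: dA => v /sU; apply: fg. Qed.

Lemma depends_onC U A : depends_on U A -> depends_on U (~: A).
Proof. by move=> dA f g fg; rewrite !inE (dA f g). Qed.

Lemma depends_on_bigcap (J : finType) (P : pred J) U (F : J -> {set {ffun V -> K}}) :
  (forall j, P j -> depends_on U (F j)) -> depends_on U (\bigcap_(j | P j) F j).
Proof.
move=> dF f g fg; apply/bigcapP/bigcapP => H j Pj.
  by rewrite -(dF j Pj f g fg) H.
by rewrite (dF j Pj f g fg) H.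
Qed.

Let glue U f g : {ffun V -> K} := [ffun v => if v \in U then f v else g v].

(* Exchanging the coordinates outside [U] maps [(A :&: B) * Omega] onto [A * B]. *)
Lemma depends_on_indep U A B : depends_on U A -> depends_on (~: U) B ->
  #|A :&: B| * #|{ffun V -> K}| = #|A| * #|B|.
Proof.
move=> dA dB; rewrite -[in LHS]cardsT -!cardsX.
pose swap (p : {ffun V -> K} * {ffun V -> K}) := (glue U p.1 p.2, glue U p.2 p.1).
have swapK : involutive swap.
  by case=> f g; congr pair; apply/ffunP=> v; rewrite !ffunE /=; case: ifP => vU;
    rewrite ?ffunE vU.
rewrite -(card_preimset _ (inv_inj swapK)); apply: eq_card => -[f g].
rewrite !inE /= andbT; congr (_ && _).
  by apply: dA => v vU; rewrite ffunE vU.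
by apply: dB => v; rewrite inE => /negbTE vU; rewrite ffunE vU.
Qed.
End Independence.

(** * Occurrences of a pattern at prescribed places *)

Section Patterns.
Variables (V : finType) (m : nat).
Local Notation Omega := {ffun V -> 'I_m}.
Local Notation q := (m ^ m).

(** The colours are the places of the pattern themselves, so the pattern sought is the identity;
    composing with a map out of ['I_m] turns it into any other pattern. *)
Definition mismatch (p : 'I_m -> V) : {set Omega} :=
  [set f : {ffun V -> 'I_m} | [exists d, f (p d) != d]].

Lemma mismatch_depends p (U : {set V}) : (forall d, p d \in U) -> depends_on U (mismatch p).
Proof.
move=> pU f g fg; rewrite !inE; apply: eq_existsb => d.
by rewrite fg.
Qed.

(* Overwriting the values at [p] by the pattern loses only the [m] overwritten values. *)
Lemma card_mismatch p : injective p -> q * #|mismatch p| <= (q - 1) * #|{: Omega}|.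
Proof.
move=> p_inj.
pose over (f : Omega) : Omega := [ffun v => odflt (f v) [pick d | p d == v]].
have overp f d : over f (p d) = d.
  rewrite ffunE; case: pickP => [d' /eqP/p_inj->|/(_ d)] //; by rewrite eqxx.
have overN f v : (forall d, p d != v) -> over f v = f v.
  by move=> H; rewrite ffunE; case: pickP => // d; rewrite (negbTE (H d)).
pose h (f : Omega) := (over f, [ffun d => f (p d)] : {ffun 'I_m -> 'I_m}).
have h_inj : injective h.
  move=> f g [e1 /ffunP e2]; apply/ffunP=> v.
  have [/existsP[d /eqP<-]|/existsPn H] := boolP [exists d, p d == v].
    by have := e2 d; rewrite !ffunE.
  by rewrite -(overN f) // -(overN g) // e1.
have : #|{: Omega}| <= #|setX (~: mismatch p) [set: {ffun 'I_m -> 'I_m}]|.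
  rewrite -cardsT -(card_imset _ h_inj); apply/subset_leq_card/subsetP=> _ /imsetP[f _ ->].
  rewrite !inE andbT negb_exists; apply/forallP=> d; by rewrite overp eqxx.
rewrite cardsX cardsT [#|{: {ffun 'I_m -> 'I_m}}|]card_ffun !card_ord mulnBl mul1n.
by rewrite -(cardsC (mismatch p)); nia.
Qed.

Variables (I : finType) (N D : nat) (pos : I -> 'I_N -> 'I_m -> V).
Hypothesis pos_inj : forall i r r' d d', pos i r d = pos i r' d' -> r = r' /\ d = d'.
Let touch i j := [exists r, exists d, exists r', exists d', pos i r d == pos j r' d'].
Hypothesis card_touch : forall i, #|[set j | touch i j]| <= D.
(** The last inequality says that missing the pattern at all [N] disjoint places, of probability at
    most (1 - 1/q)^N, is as rare as [local_lemma] demands. *)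
Hypotheses (m_gt0 : 0 < m) (D_gt0 : 0 < D) (N_large : 4 * D * (q - 1) ^ N <= q ^ N).

Let bad i := \bigcap_(r < N) mismatch (pos i r).
Let supp i := [set v | [exists r, exists d, pos i r d == v]].

Let supp_pos i r d : pos i r d \in supp i.
Proof. by rewrite inE; apply/existsP; exists r; apply/existsP; exists d. Qed.

Let bad_depends i : depends_on (supp i) (bad i).
Proof. by apply: depends_on_bigcap => r _; apply: mismatch_depends => d. Qed.

Let Omega_gt0 : 0 < #|{: Omega}|.
Proof. by rewrite card_ffun card_ord expn_gt0 m_gt0. Qed.

(** For fixed [i] the places for distinct [r] are disjoint, so the mismatches are independent and
    the bounds of [card_mismatch] multiply. *)
Let card_bad i : q ^ N * #|bad i| <= (q - 1) ^ N * #|{: Omega}|.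
Proof.
suff H k : k <= N -> q ^ k * #|\bigcap_(r < N | r < k) mismatch (pos i r)| <=
                     (q - 1) ^ k * #|{: Omega}|.
  have := H N (leqnn N); congr (_ * #|pred_of_set _| <= _).
  by apply: eq_bigl => r; rewrite ltn_ord.
elim: k => [_|k IH kN].
  by rewrite !expn0 !mul1n max_card.
have -> : \bigcap_(r < N | r < k.+1) mismatch (pos i r) =
    mismatch (pos i (Ordinal kN)) :&: \bigcap_(r < N | r < k) mismatch (pos i r).
  rewrite (bigD1 (Ordinal kN)) //=; congr (_ :&: _); apply: eq_bigl => r.
  by rewrite -val_eqE /=; lia.
set B := \bigcap_(r < N | r < k) _; set M := mismatch _.
pose U := [set pos i (Ordinal kN) d | d : 'I_m].
have dM : depends_on U M by apply: mismatch_depends => d; apply/imsetP; exists d.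
have dB : depends_on (~: U) B.
  apply: depends_on_bigcap => r rk; apply: mismatch_depends => d.
  rewrite inE; apply/imsetP => -[d' _ /pos_inj[e _]].
  by rewrite e /= ltnn in rk.
have indep := depends_on_indep dM dB.
have := @card_mismatch (pos i (Ordinal kN)) (fun d d' e => (pos_inj e).2).
have {IH} := IH (ltnW kN); rewrite -/B -/M => le1 le2.
rewrite -(leq_pmul2r Omega_gt0) -mulnA indep !expnS.
have := leq_mul le2 le1.
by rewrite mulnACA [X in _ <= X -> _]mulnACA [X in _ <= X -> _]mulnA.
Qed.

(** The local lemma applies with [touch] as dependency relation: events not touching [i] depend on
    coordinates outside [supp i], hence are independent of [bad i]. *)
Lemma pattern_exists : exists f : Omega, forall i, exists r, forall d, f (pos i r d) = d.
Proof.
have [|f Hf] := @local_lemma _ _ bad _ D Omega_gt0 D_gt0 card_touch.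
  move=> i S dis; set B := \bigcap_(j in S) ~: bad j.
  have dB : depends_on (~: supp i) B.
    apply: depends_on_bigcap => j jS; apply: depends_onC.
    apply: depends_onS (@bad_depends j); apply/subsetP=> v.
    rewrite !inE => /existsP[r' /existsP[d' /eqP<-]].
    apply/existsP=> -[r /existsP[d e]].
    move/disjointFr: dis => /(_ j jS); rewrite inE => /existsP; apply.
    by exists r; apply/existsP; exists d; apply/existsP; exists r'; apply/existsP;
      exists d'.
  have indep := depends_on_indep (@bad_depends i) dB.
  rewrite setIC -(leq_pmul2r Omega_gt0) -mulnA indep.
  rewrite -(leq_pmul2l (m := q ^ N)); last by rewrite !expn_gt0 m_gt0.
  have := leq_mul (leq_mul N_large (leqnn #|{: Omega}|)) (leqnn #|B|).
  have := leq_mul (leq_mul (leqnn (4 * D)) (@card_bad i)) (leqnn #|B|).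
  have combine a Q P X Y W : a * (Q * X) * Y <= a * (P * W) * Y ->
    a * P * W * Y <= Q * W * Y -> Q * (a * (X * Y)) <= Q * (Y * W) by nia.
  exact: combine.
exists f => i; have := Hf i; rewrite /bad => H.
have : ~~ [forall r, f \in mismatch (pos i r)].
  by apply: contra H => /forallP H; apply/bigcapP.
case/forallPn=> r; rewrite inE negb_exists => /forallP Hr.
by exists r => d; apply/eqP; rewrite -[_ == _]negbK.
Qed.
End Patterns.

(** Needed because the dependency degree grows quadratically with the number [N] of places, while
    the failure probability decays exponentially. *)
Lemma exp_beats_square (c q : nat) : 0 < q ->
  exists2 N, 0 < N & c * N ^ 2 * (q - 1) ^ N <= q ^ N.
Proof.
case: q => // p _; rewrite subn1 /=.
have [->|p_gt0] := posnP p; first by exists 1; rewrite ?expn1 ?muln0.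
(* From Bernoulli's inequality (1 + 1/p)^M >= 1 + M/p. *)
have lin M : M * p ^ M <= p * p.+1 ^ M.
  suff : (p + M) * p ^ M <= p * p.+1 ^ M.
      by apply: leq_trans; rewrite leq_mul2r leq_addl orbT.
  elim: M => [|M IH]; first by rewrite addn0 !expn0.
  have := leq_mul (leqnn p.+1) IH; rewrite !expnS; nia.
(* With N = 4M, the fourth power of [lin] suffices once M^2 >= 16 c p^4. *)
pose M := 4 * c.+1 * p ^ 2; have P_gt0 : 0 < p ^ 2 by rewrite expn_gt0 p_gt0.
exists (M * 4); first by rewrite /M; lia.
rewrite -(leq_pmul2l (m := p ^ 4)) ?expn_gt0 ?p_gt0 //.
apply: leq_trans (_ : (M * p ^ M) ^ 4 <= _); last first.
  by rewrite [p.+1 ^ _]expnM -expnMn leq_exp2r.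
rewrite [leqRHS]expnMn -expnM !mulnA leq_mul2r; apply/orP; right.
have M2 : 16 * c * p ^ 4 <= M ^ 2.
  by rewrite /M -[4]/(2 * 2) expnM -!mulnn; move: (p * p) => P; nia.
have := leq_mul (leqnn (M ^ 2)) M2.
by rewrite -expnD expnMn; move: (p ^ 4) (M ^ 2) (M ^ _) => a b e; lia.
Qed.

(** * Minimal flows *)

Local Arguments gmul {g}.
Local Arguments ginv {g}.
Local Arguments gone {g}.
Local Arguments gmul_assoc {g}.
Local Arguments gmul_1l {g}.
Local Arguments gmul_Vl {g}.

Section GroupFacts.
Variable G : Group.
Implicit Types a b c : G.

Lemma gmulKl a b : gmul (ginv a) (gmul a b) = b.
Proof. by rewrite gmul_assoc gmul_Vl gmul_1l. Qed.

Lemma gmul_injl a : injective (gmul a).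
Proof. by move=> b c e; rewrite -(gmulKl a b) e gmulKl. Qed.

Lemma gmul_1r a : gmul a gone = a.
Proof. by apply: (@gmul_injl (ginv a)); rewrite gmulKl gmul_Vl. Qed.

Lemma gmul_Vr a : gmul a (ginv a) = gone.
Proof. by apply: (@gmul_injl (ginv a)); rewrite gmulKl gmul_1r. Qed.

Lemma gmulKr a b : gmul (gmul b a) (ginv a) = b.
Proof. by rewrite -gmul_assoc gmul_Vr gmul_1r. Qed.

Lemma gmul_injr a b c : gmul b a = gmul c a -> b = c.
Proof. by move=> e; rewrite -(gmulKr a b) e gmulKr. Qed.
End GroupFacts.

Definition infinite_type (T : Type) := ~ exists l : list T, forall x, List.In x l.

Lemma infinite_fresh T : infinite_type T -> forall l : list T, exists x, ~ List.In x l.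
Proof. by move=> infT l; apply/existsNP => H; apply: infT; exists l. Qed.

Lemma leq_card_functional (T J : finType) (P : T -> pred J) :
  (forall t j j', P t j -> P t j' -> j = j') -> #|[set j | [exists t, P t j]]| <= #|T|.
Proof.
move=> Pfun; have Some_inj : injective (@Some J) by move=> j j' [].
rewrite -(card_imset _ Some_inj).
apply: leq_trans (leq_imset_card (fun t => [pick j | P t j]) T).
apply/subset_leq_card/subsetP=> _ /imsetP[j + ->]; rewrite inE => /existsP[t Ptj].
apply/imsetP; exists t => //; case: pickP => [j' Ptj'|/(_ j)]; last by rewrite Ptj.
by rewrite (Pfun _ _ _ Ptj Ptj').
Qed.

Section MinimalFlow.
Variables (G : Group) (X : Flow G) (minX : minimal_flow X).
Implicit Types (U : fpt X -> Prop) (x y : fpt X).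

Lemma minimal_finite_cover U : fopen X U -> (exists y, U y) ->
  exists F : list G, forall x, exists g, List.In g F /\ U (fact X g x).
Proof.
move=> oU neU.
have [F|x|l [lF lcov]] := @fcompact G X (fun V => exists g : G, V = (fun x => U (fact X g x))).
- by case=> g ->; apply: fact_cont.
- have [g Ug] := minX x oU neU.
  by exists (fun x => U (fact X g x)); split=> //; exists g.
suff [F FP] : exists F : list G, forall V x, List.In V l -> V x ->
    exists g, List.In g F /\ U (fact X g x).
  by exists F => x; have [V [Vl Vx]] := lcov x; apply: FP Vx.
elim: l lF {lcov} => [|V l IH] lF; first by exists [::].
have [V' V'l|F FP] := IH; first by apply: lF; right.
have [g Vg] := lF V (or_introl erefl); exists (g :: F) => W x [<-|Wl] Wx.
  by exists g; split; [left | rewrite Vg in Wx].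
by have [k [kF Uk]] := FP W x Wl Wx; exists k; split; [right|].
Qed.

(** Return times are syndetic: for every [h] some [gmul f h] with [f] in the finite set [F] is one.
    If all lay in [L], the group would be the finite set of products of an inverse from [F] and an
    element of [L]. *)
Lemma return_times_infinite U x : infinite_group G -> fopen X U -> U x ->
  forall L : list G, exists g, U (fact X g x) /\ ~ List.In g L.
Proof.
move=> infG oU Ux L; have [F FP] := minimal_finite_cover oU (ex_intro _ _ Ux).
have [h hP] := infinite_fresh infG
  (List.flat_map (fun f => List.map (gmul (ginv f)) L) F).
have [f [fF Uf]] := FP (fact X h x).
exists (gmul f h); split; first by rewrite fact_mul.
move=> fhL; apply: hP; apply/List.in_flat_map; exists f; split=> //.
by apply/List.in_map_iff; exists (gmul f h); rewrite gmulKl.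
Qed.

Lemma fopen_forall (T : Type) (l : list T) (U : T -> fpt X -> Prop) :
  (forall t, List.In t l -> fopen X (U t)) ->
  fopen X (fun x => forall t, List.In t l -> U t x).
Proof.
elim: l => [|t l IH] oU.
  have -> : (fun x => forall t, List.In t [::] -> U t x) = (fun _ => True).
    by apply/funext => x; apply/propext; split.
  exact: fopen_full.
have -> : (fun x => forall s, List.In s (t :: l) -> U s x) =
          (fun x => U t x /\ forall s, List.In s l -> U s x).
  apply/funext => x; apply/propext; split=> [H|[Ut Ul] s [<-|]] //; last exact: Ul.
  by split=> [|s sl]; apply: H; [left | right].
apply: fopen_inter; first by apply: oU; left.
by apply: IH => s sl; apply: oU; right.
Qed.

(** Greedy choice: the next return time avoids the finitely many elements a^-1 b r_i. *)
Lemma separated_return_times U x (E : list G) n : infinite_group G -> fopen X U -> U x ->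
  exists r : nat -> G, (forall i, U (fact X (r i) x)) /\
    (forall i j a b, i < n -> j < n -> List.In a E -> List.In b E ->
       gmul a (r i) = gmul b (r j) -> i = j).
Proof.
move=> infG oU Ux; elim: n => [|n [r [rU rsep]]].
  by exists (fun=> gone); split=> // i; rewrite fact_one.
have [g [Ug gP]] := return_times_infinite infG oU Ux
  (List.flat_map (fun i => List.flat_map (fun a => List.map (fun b =>
     gmul (ginv a) (gmul b (r i))) E) E) (List.seq 0 n)).
have gsep i a b : i < n -> List.In a E -> List.In b E -> gmul a g <> gmul b (r i).
  move=> lt_in aE bE e; apply: gP; apply/List.in_flat_map; exists i; split.
    by apply/List.in_seq; lia.
  apply/List.in_flat_map; exists a; split=> //; apply/List.in_map_iff; exists b.
  by rewrite -e gmulKl.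
exists (fun i => if i == n then g else r i); split=> [i|i j a b].
  by case: eqP.
move=> lt_i lt_j aE bE; case: (eqVneq i n) => [->|ni]; case: (eqVneq j n) => [->|nj] //=.
- by move/gsep => H; case: H => //; lia.
- by move/esym/gsep => H; case: H => //; lia.
- by apply: rsep => //; lia.
Qed.

(** Both (i) and (ii) rest on this. [z] and the finite [F] are fixed before [x], which is what
    allows (ii) to iterate the statement. *)
Lemma pattern_cover U x0 (K : Type) (E : list G) (alpha : G -> K) :
  infinite_group G -> fopen X U -> U x0 ->
  exists (z : G -> K) (F : list G), forall x, exists g, [/\ List.In g F,
    U (fact X g x) & forall e, List.In e E -> z (gmul e g) = alpha e].
Proof.
move=> infG oU Ux0.
have mem_In (H : eqType) (h : H) s : h \in s -> List.In h s.
  by elim: s => // k s IH; rewrite inE => /predU1P[->|/IH]; [left|right].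
have In_mem (H : eqType) (h : H) s : List.In h s -> h \in s.
  by elim: s => // k s IH /= [->|/IH]; rewrite inE ?eqxx // => ->; rewrite orbT.
(* Adding [gone] makes the pattern nonempty, and [undup] makes its places distinct. *)
pose E' : seq {classic G} := undup (gone :: E : seq {classic G}).
pose m := size E'; pose elt (d : nat) : G := nth (gone : {classic G}) E' d.
have m_gt0 : 0 < m.
  rewrite lt0n size_eq0; apply/eqP => E'0.
  by have := mem_undup (gone :: E : seq {classic G}) gone; rewrite -/E' E'0 inE eqxx.
have eltE d : d < m -> List.In (elt d) E'.
  by move=> dm; exact: (@mem_In {classic G} _ _ (mem_nth _ dm)).
have elt_inj d d' : d < m -> d' < m -> elt d = elt d' -> d = d'.
  move=> dm d'm e; apply/eqP; rewrite -(nth_uniq (gone : {classic G}) dm d'm (undup_uniq _)).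
  exact/eqP.
(* The degree will be (N m)^2, whence the constant 4 m^2. It does not depend on the return times,
   which are chosen after [N]. *)
have [|N N_gt0 N_large] := @exp_beats_square (4 * m ^ 2) (m ^ m).
  by rewrite expn_gt0 m_gt0.
have [r [rU rsep]] := separated_return_times E' N infG oU Ux0.
pose W y := forall i, List.In i (List.seq 0 N) -> U (fact X (r i) y).
have [||F' F'P] := @minimal_finite_cover W.
- by apply: fopen_forall => i _; apply: fact_cont.
- by exists x0 => i _; apply: rU.
(* All places e r_k h lie in the finite set [S], the coordinate set [V]; there is one bad event for
   each [h] in [F']. *)
pose R' : seq {classic G} := [seq gmul e (r k) : {classic G} | e <- E', k <- iota 0 N].
pose S : seq {classic G} := [seq gmul t h : {classic G} | t <- R', h <- (F' : seq {classic G})].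
pose I := seq_sub (F' : seq {classic G}); pose V := seq_sub S.
have posP (h : I) (k : 'I_N) (d : 'I_m) : gmul (gmul (elt d) (r k)) (val h) \in S.
  apply/(@allpairsP {classic G} {classic G} {classic G} (fun t h => gmul t h) R' F').
  exists (gmul (elt d) (r k) : {classic G}, val h : {classic G}); split=> //.
    apply/(@allpairsP {classic G} nat {classic G} (fun e k => gmul e (r k)) E' (iota 0 N)).
    exists (elt d : {classic G}, val k); split=> //; first exact: mem_nth.
    by rewrite mem_iota ltn_ord.
  exact: valP.
pose pos h k d : V := SeqSub (posP h k d).
have pos_inj h k k' d d' : pos h k d = pos h k' d' -> k = k' /\ d = d'.
  move=> /(congr1 val)/= /gmul_injr e.
  have kk' : k = k'.
    by apply/val_inj/(rsep k k' (elt d) (elt d')); rewrite ?ltn_ord //; apply: eltE.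
  split=> //; subst k'; apply/val_inj/(elt_inj _ _ (ltn_ord d) (ltn_ord d')).
  exact: (gmul_injr e).
have [|||f fP] := @pattern_exists V m I N ((N * m) ^ 2) pos pos_inj _ m_gt0.
(* By cancellation, each quadruple of indices of a coincidence determines [j]. *)
- move=> i; apply: leq_trans (_ : #|[set j | [exists t : ('I_N * 'I_m) * ('I_N * 'I_m),
    pos i t.1.1 t.1.2 == pos j t.2.1 t.2.2]]| <= _).
    apply/subset_leq_card/subsetP=> j; rewrite !inE.
    move=> /existsP[k /existsP[d /existsP[k' /existsP[d' e]]]].
    by apply/existsP; exists ((k, d), (k', d')).
  apply: leq_trans (@leq_card_functional _ _ _ _) _; last by rewrite !card_prod !card_ord mulnn.
  move=> t j j' /eqP e1 /eqP e2; rewrite {}e1 in e2; apply/val_inj.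
  move: e2 => /(congr1 val) /= e2; exact: (gmul_injl e2).
- by rewrite expn_gt0 muln_gt0 N_gt0 m_gt0.
- by rewrite expnMn [N ^ 2 * _]mulnC mulnA.
(* The colour at a place names an element of [E'], and [alpha] turns the identity pattern into the
   wanted one; [alpha gone] is the default off [S]. *)
pose z g := if insub (g : {classic G}) is Some v then alpha (elt (f (v : V))) else alpha gone.
exists z, (List.flat_map (fun h => List.map (fun k => gmul (r k) h) (List.seq 0 N)) F') => x.
have [h [hF' Wh]] := F'P x.
pose i : I := SeqSub (@In_mem {classic G} _ _ hF'); have [k kP] := fP i.
have kN : List.In (val k) (List.seq 0 N).
  by apply/List.in_seq; split; [lia | exact/ltP/(ltn_ord k)].
exists (gmul (r k) h); split.
- by apply/List.in_flat_map; exists h; split=> //; apply/List.in_map_iff; exists (val k).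
- by rewrite fact_mul; apply: Wh.
move=> e eE; have eE' : (e : {classic G}) \in E'.
  by rewrite mem_undup; apply: (@In_mem {classic G} e (gone :: E)); right.
have dm : index (e : {classic G}) E' < m by rewrite index_mem.
have elt_e : elt (index (e : {classic G}) E') = e by exact: (@nth_index {classic G} gone e E' eE').
rewrite /z gmul_assoc -[in X in insub X]elt_e.
by rewrite -[gmul _ h]/(val (pos i k (Ordinal dm))) valK kP elt_e.
Qed.
End MinimalFlow.

(** A point outside [C] has a box around it missing [C], a cylinder over [E] times [B]. With [z]
    from [pattern_cover], any point of [C] over [z] has a translate in the box. *)
Lemma bern_disjoint (G : Group) (X : Flow G) : infinite_group G -> minimal_flow X ->
  disjoint_flows (bern_open G) (bern_act G) (fopen X) (fact X).
Proof.
move=> infG minX C clC invC projC _ [z0 x0]; apply: contrapT => nC.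
have [A [B [/(_ z0)oA [oB [/= /oA[E EP] [Bx0 AB]]]]]] := clC _ nC.
have [z [F zF]] := pattern_cover minX E z0 infG oB Bx0.
have [x Czx] := projC z; have [g [_ Bgx zg]] := zF x.
apply: (AB (bern_act G g z) (fact X g x)) => //; last exact: invC.
by apply: EP => e /zg.
Qed.

(** * A function realising all finite patterns *)

From mathcomp Require Import classical_sets wochoice.
Local Open Scope classical_set_scope.

(** * Cardinal arithmetic of infinite types *)

Definition embeds (A B : Type) := exists f : A -> B, injective f.

Lemma embeds_trans A B C : embeds A B -> embeds B C -> embeds A C.
Proof. by case=> f fi [g gi]; exists (g \o f); apply: inj_comp. Qed.

Lemma embeds_pair A B C D : embeds A C -> embeds B D -> embeds (A * B) (C * D).
Proof.
case=> f fi [g gi]; exists (fun p => (f p.1, g p.2)).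
by move=> [a b] [a' b'] [/fi-> /gi->].
Qed.

Definition partial_injection A B (S : set (A * B)) :=
  forall p q, S p -> S q -> (p.1 = q.1 <-> p.2 = q.2).

(** A maximal partial injection is total on one side, since otherwise one more pair could be
    added. *)
Lemma embeds_total A B : embeds A B \/ embeds B A.
Proof.
have [F FP totF|S [PS maxS]] := @Zorn_bigcup (A * B) (@partial_injection A B).
  move=> p q [X FX Xp] [Y FY Yq].
  by have [XY|YX] := totF _ _ FX FY; [apply: (FP _ FY); auto | apply: (FP _ FX); auto].
have [/choice[f Sf]|/existsNP[a /forallNP Sa]] := pselect (forall a, exists b, S (a, b)).
  by left; exists f => a a' e; apply/(PS _ _ (Sf a) (Sf a')).
have [/choice[f Sf]|/existsNP[b /forallNP Sb]] := pselect (forall b, exists a, S (a, b)).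
  by right; exists f => b b' e; apply/(PS _ _ (Sf b) (Sf b')).
case: (maxS (S `|` [set (a, b)])).
  split; first by move=> p Sp; left.
  by move=> /(_ (a, b) (or_intror erefl)); apply: Sa.
move=> [a1 b1] [a2 b2] /= [S1|[-> ->]] [S2|[-> ->]] //; first exact: PS S1 S2.
  by split=> e; move: S1; rewrite e; [move/Sa | move/Sb].
by split=> e; move: S2; rewrite -e; [move/Sa | move/Sb].
Qed.

Lemma infinite_embeds_nat T : infinite_type T -> embeds nat T.
Proof.
move=> /infinite_fresh/choice[fresh freshP].
pose s := fix s n := if n is n'.+1 then fresh (s n') :: s n' else [::].
have sS n k : n < k -> List.In (fresh (s n)) (s k).
  elim: k => // k IH; rewrite ltnS leq_eqVlt => /orP[/eqP->|/IH] /=; by [left|right].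
exists (fun n => fresh (s n)) => n k e.
by have [lt|lt|//] := ltngtP n k; have := sS _ _ lt; [rewrite e|rewrite -e] => /freshP.
Qed.

(* [S] is the graph of an injection [D * D -> D] for some subset [D]. *)
Definition pairing_graph A (S : set ((A * A) * A)) :=
  let D := [set x | exists2 p, S p & x = p.1.1 \/ x = p.1.2 \/ x = p.2] in
  partial_injection S /\ (forall x y, D x -> D y -> exists z, S ((x, y), z)).

(** Hessenberg's theorem: take a maximal pairing, on a subset [D]. If [D] embeds in its complement,
    the pairing extends to a copy of [D] there; otherwise the complement embeds in [D], and hence so
    does [A]. *)
Lemma embeds_square A : infinite_type A -> embeds (A * A) A.
Proof.
move=> /infinite_embeds_nat[s s_inj].
pose S0 : set ((A * A) * A) := [set p | exists i j, p = ((s i, s j), s (pickle (i, j)))].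
have PS0 : pairing_graph S0.
  split.
    move=> _ _ [i [j ->]] [i' [j' ->]] /=; split=> [[/s_inj-> /s_inj->] //|].
    by move=> /s_inj/(pcan_inj pickleK)[-> ->].
  have S0D x : (exists2 p, S0 p & x = p.1.1 \/ x = p.1.2 \/ x = p.2) -> exists i, x = s i.
    by move=> [_ [i [j ->]] /= [|[]] ->]; eexists.
  by move=> x y /S0D[i ->] /S0D[j ->]; eexists; exists i, j.
(* Zorn's lemma runs over extensions of [S0], so that [D] contains all [s i], later used as distinct
   tags. *)
pose P := [set S | pairing_graph (S0 `|` S)].
have [F FP totF|S [PS maxS]] := @Zorn_bigcup _ P.
  set T := \bigcup_(X in F) X.
  have dir p q : (S0 `|` T) p -> (S0 `|` T) q ->
      exists X, [/\ P X, X `<=` T, (S0 `|` X) p & (S0 `|` X) q].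
    have mk X r r' : F X -> (S0 `|` X) r -> (S0 `|` X) r' ->
      exists X, [/\ P X, X `<=` T, (S0 `|` X) r & (S0 `|` X) r'].
      by move=> FX; exists X; split=> //; [exact: FP | move=> t Xt; exists X].
    case=> [Sp|[X FX Xp]] [Sq|[Y FY Yq]].
    - exists set0; split=> //; try by left.
      by rewrite /P /= setU0.
    - by apply: (mk Y) => //; [left | right].
    - by apply: (mk X) => //; [right | left].
    - have [XY|YX] := totF _ _ FX FY; [apply: (mk Y) => //|apply: (mk X) => //]; right; auto.
  split.
    by move=> p q Tp Tq; have [X [[PX _] _ Xp Xq]] := dir _ _ Tp Tq; apply: PX.
  move=> x y [p Tp px] [q Tq qy]; have [X [[_ PX] XT Xp Xq]] := dir _ _ Tp Tq.
  have [||z Hz] := PX x y; [by exists p | by exists q |].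
  by exists z; case: Hz => [?|/XT]; [left|right].
set T := S0 `|` S in PS; case: PS => T_inj T_dom.
pose D := [set x | exists2 p, T p & x = p.1.1 \/ x = p.1.2 \/ x = p.2].
have sD i : D (s i) by exists ((s i, s i), s (pickle (i, i))) => /=; [left; exists i, i|left].
have /choice[F0 F0P] : forall p : {x | D x} * {x | D x}, exists z : {x | D x},
    T ((sval p.1, sval p.2), sval z).
  move=> [[x Dx] [y Dy]] /=; have [z Tz] := T_dom x y Dx Dy.
  have Dz : D z by exists ((x, y), z) => //=; right; right.
  by exists (exist _ z Dz).
have eq_sval (u v : {x | D x}) : sval u = sval v -> u = v.
  by case: u v => [x Dx] [y Dy] /= e; subst y; congr exist; apply: Prop_irrelevance.
have F_inj : injective F0.
  move=> [x y] [x' y'] e; have := T_inj _ _ (F0P (x, y)) (F0P (x', y')).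
  by rewrite /= e => -[_ /(_ erefl)[/eq_sval-> /eq_sval->]].
pose d i : {x | D x} := exist _ (s i) (sD i).
have d_inj : injective d by move=> i j /(congr1 sval)/s_inj.
have [[j j_inj]|[k k_inj]] := embeds_total {x | D x} {x | ~ D x}.
  (* [outD] is a copy of [D] outside [D]. The three new blocks of pairs all go into this copy, kept
     apart by the tags 0, 1, 2 in [code]. *)
  pose inD (x : {x | D x}) := sval x; pose outD (x : {x | D x}) := sval (j x).
  pose code t x y := outD (F0 (d t, F0 (x, y))).
  pose N : set ((A * A) * A) := [set p | exists x y,
    [\/ p = ((inD x, outD y), code 0 x y), p = ((outD x, inD y), code 1 x y)
      | p = ((outD x, outD y), code 2 x y)]].
  have out_inj x y : outD x = outD y -> x = y.
    rewrite /outD => e; apply: j_inj; case: (j x) (j y) e => [u Du] [v Dv] /= e.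
    by subst v; congr exist; apply: Prop_irrelevance.
  have outN x : ~ D (outD x) by exact: (svalP (j x)).
  have inout x y : inD x <> outD y by move=> e; apply: (outN y); rewrite -e; apply: svalP.
  have outin x y : outD y <> inD x by move=> e; apply: (inout x y).
  have code_inj t x y t' x' y' : code t x y = code t' x' y' -> [/\ t = t', x = x' & y = y'].
    by move=> /out_inj/F_inj[/s_inj-> /F_inj[-> ->]].
  have TN p q : T p -> N q -> ~ (p.1 = q.1 \/ p.2 = q.2).
    have TD r : T r -> [/\ D r.1.1, D r.1.2 & D r.2].
      by move=> Tr; split; exists r => //; [left | right; left | right; right].
    move=> /TD[D1 D2 D3] [x [y [] ->]] /= [e|e]; rewrite e in D1 D2 D3;
      exact: outN D1 || exact: outN D2 || exact: outN D3.
  have N_inj : partial_injection N.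
  { move=> _ _ [x [y [] ->]] [x' [y' [] ->]] /=; split.
    all: try by move=> /code_inj[] // _ -> ->.
    all: move=> [].
    all: try by move=> /inout.
    all: try by move=> /outin.
    all: try by move=> _ /inout.
    all: try by move=> _ /outin.
    + by move=> /eq_sval-> /out_inj->.
    + by move=> /out_inj-> /eq_sval->.
    + by move=> /out_inj-> /out_inj->. }
  case: (maxS (S `|` N)).
    split; first by move=> p Sp; left.
    move=> /(_ ((inD (d 0), outD (d 0)), code 0 (d 0) (d 0))) H.
    have NN : N ((inD (d 0), outD (d 0)), code 0 (d 0) (d 0)).
      by exists (d 0), (d 0); constructor 1.
    by apply: (TN _ _ _ NN); [right; apply: H; right | left].
  rewrite /P /= setUA -/T; split.
    move=> p q [Tp|Np] [Tq|Nq]; first exact: T_inj.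
    - by have H := TN _ _ Tp Nq; split=> e; case: H; [left|right].
    - by have H := TN _ _ Tq Np; split=> e; case: H; [left|right].
    exact: N_inj.
  have fld x : (exists2 p, (T `|` N) p & x = p.1.1 \/ x = p.1.2 \/ x = p.2) ->
      exists u, x = inD u \/ x = outD u.
    case=> p [Tp xp|[u [v Nuv]]].
      have Dx : D x by exists p.
      by exists (exist _ x Dx); left.
    by case: Nuv => -> /= [|[]] ->; eexists; by [left | right].
  move=> x y /fld[u xu] /fld[v yv]; case: xu yv => -> [] ->.
  - by exists (sval (F0 (u, v))); left; apply: (F0P (u, v)).
  - by exists (code 0 u v); right; exists u, v; constructor 1.
  - by exists (code 1 u v); right; exists u, v; constructor 2.
  - by exists (code 2 u v); right; exists u, v; constructor 3.
(* Tags 0 and 1 separate the elements of [D] from those of its complement. *)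
have AD : embeds A {x | D x}.
  have /choice[e eP] : forall x : A, exists z, (exists Dx : D x, z = F0 (d 0, exist _ x Dx)) \/
      (exists Dx : ~ D x, z = F0 (d 1, k (exist _ x Dx))).
    move=> x; have [Dx|Dx] := pselect (D x); first by eexists; left; exists Dx.
    by eexists; right; exists Dx.
  exists e => x y exy; have := eP x; rewrite exy.
  case: (eP y) => -[Dy ->] [] [Dx] /F_inj.
  - by case.
  - by case=> /s_inj.
  - by case=> /s_inj.
  - by case=> /k_inj[].
apply: embeds_trans (embeds_pair AD AD) _.
apply: embeds_trans (ex_intro _ _ F_inj) _.
by exists sval => u v /eq_sval.
Qed.

(** The end marker [s 0] may itself code a pair, so the length is recorded too. *)
Lemma embeds_list A : infinite_type A -> embeds (list A) A.
Proof.
move=> infA; have [f fi] := embeds_square infA; have [s si] := infinite_embeds_nat infA.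
pose code := fix code (l : list A) := if l is x :: l' then f (x, code l') else s 0.
exists (fun l => f (s (length l), code l)) => l l' /fi[/si].
elim: l l' => [|x l IH] [|x' l'] //= [e] /fi[-> /IH]; by move/(_ e)->.
Qed.

(** The order type is an initial ordinal: if [T] embeds in some initial segment of a well-order,
    take the least such segment and pull its order back along the embedding. *)
Lemma initial_well_order T : exists lt : T -> T -> Prop, [/\ well_founded lt,
  forall x y, [\/ lt x y, x = y | lt y x] & forall x, ~ embeds T {y | lt y x}].
Proof.
have [R Rwo] := well_ordering_principle {classic T}.
pose lt (x y : T) := ~ R y x.
have lt_wf : well_founded lt.
  move=> x; apply/not_notP => nx.
  have [|z [[/asboolP nz min] _]] := Rwo [pred x | `[< ~ Acc lt x >]].
    by exists x; apply/asboolP.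
  apply: nz; constructor=> y ltyz; apply/not_notP => ny; apply: ltyz.
  by apply: min; apply/asboolP.
have lt_total x y : [\/ lt x y, x = y | lt y x].
  have Rxx z : R z z.
    have [|t [[/eqP <- min] _]] := Rwo (pred1 (z : {classic T})); first by exists z; apply/eqP.
    by apply: min; apply/eqP.
  have [Rxy|?] := pselect (R x y); last by constructor 3.
  have [Ryx|?] := pselect (R y x); last by constructor 1.
  constructor 2.
  have [|z [_ uz]] := Rwo (pred2 (x : {classic T}) y).
    by exists x; rewrite inE eqxx.
  transitivity z; [symmetry|]; apply: uz; split; rewrite ?inE ?eqxx ?orbT //.
    by move=> t; rewrite !inE => /orP[] /eqP->.
  by move=> t; rewrite !inE => /orP[] /eqP->.
have [[x0 x0P]|/forallNP none] := pselect (exists x, embeds T {y | lt y x}); last by exists lt.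
elim: (lt_wf x0) x0P => {}x0 _ IH [e ei].
have [[x1 [x10 x1P]]|none] := pselect (exists x, lt x x0 /\ embeds T {y | lt y x}).
  exact: IH x10 x1P.
exists (fun x y => lt (sval (e x)) (sval (e y))).
have ei' x y : sval (e x) = sval (e y) -> x = y.
  move=> exy; apply: ei; case: (e x) (e y) exy => [u Du] [v Dv] /= uv.
  by subst v; congr exist; apply: Prop_irrelevance.
split.
- exact: (wf_inverse_image _ _ lt (fun x => sval (e x))).
- move=> x y; have [?|/ei' ?|?] := lt_total (sval (e x)) (sval (e y));
    by [constructor 1|constructor 2|constructor 3].
move=> x [f fi]; apply: none; exists (sval (e x)); split; first exact: (svalP (e x)).
exists (fun t => exist _ (sval (e (sval (f t)))) (svalP (f t))).
move=> t t' [/ei' ftt']; apply: fi; case: (f t) (f t') ftt' => [u Du] [v Dv] /= uv.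
by subst v; congr exist; apply: Prop_irrelevance.
Qed.

Local Close Scope classical_set_scope.

Lemma wf_choice T U (lt : T -> T -> Prop) (Good : forall p, ({q | lt q p} -> U) -> U -> Prop) :
  well_founded lt -> (forall p f, exists g, Good p f g) ->
  exists h : T -> U, forall p, Good p (fun q => h (sval q)) (h p).
Proof.
move=> lt_wf ex; pose step p f := sval (cid (ex p f)).
pose F p (rec : forall q, lt q p -> U) := step p (fun q => rec (sval q) (svalP q)).
exists (Fix lt_wf (fun _ => U) F) => p; rewrite Fix_eq; first exact: (svalP (cid (ex p _))).
by move=> q f g fg; congr (step q _); apply/funext => r; apply: fg.
Qed.

(* The patterns, lists of pairs (element, value), are well-ordered with fewer than [#|G|]
   predecessors each; the translate [h p] showing [p] is chosen disjoint from all earlier ones. *)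
Lemma universal_function (G : Group) : infinite_group G -> exists phi : G -> bool,
  forall (w : G -> bool) (E : list G), exists h, forall e, List.In e E -> phi (gmul e h) = w e.
Proof.
move=> infG; pose T := list (G * bool); pose keys (p : T) := List.map fst p.
have [lt [lt_wf lt_total lt_small]] := initial_well_order T.
have nat_bool : embeds bool nat by exists nat_of_bool; case; case.
have T_G : embeds T G.
  have GboolG : embeds (G * bool) G.
    apply: embeds_trans (embeds_square infG).
    by apply: embeds_pair (embeds_trans nat_bool (infinite_embeds_nat infG)); exists id.
  apply: embeds_trans GboolG; apply: embeds_list => -[l lP]; apply: infG.
  by exists (List.map fst l) => g; apply: (List.in_map fst l (g, true)).
pose Good p (f : {q | lt q p} -> G) g := forall q a b, List.In a (keys p) ->
  List.In b (keys (sval q)) -> gmul a g <> gmul b (f q).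
have [p f|h hP] := @wf_choice _ _ lt Good lt_wf.
  (* A blocked [g] is determined by an earlier [q] and two positions in the key lists. If all were
     blocked, [G] would embed in the predecessors of [p] times pairs of naturals: too small if these
     are infinite, and otherwise making [G] finite. *)
  apply/not_notP => /forallNP blocked.
  have /choice[c cP] : forall g, exists t : {q | lt q p} * (nat * nat), exists a b,
      [/\ List.nth_error (keys p) t.2.1 = Some a,
          List.nth_error (keys (sval t.1)) t.2.2 = Some b & gmul a g = gmul b (f t.1)].
    move=> g; have /existsNP[q /existsNP[a /existsNP[b]]] := blocked g.
    case/not_implyP=> aE /not_implyP[bE /contrapT e].
    have [i ia] := List.In_nth_error _ _ aE; have [j jb] := List.In_nth_error _ _ bE.
    by exists (q, (i, j)), a, b; split.
  have c_inj : injective c.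
    move=> g g' e; have [a [b [ia jb ab]]] := cP g; have := cP g'; rewrite -e.
    by move=> [a' [b' []]]; rewrite ia jb => -[<-] [<-]; rewrite -ab => /gmul_injl->.
  case: (lt_small p); apply: embeds_trans T_G _.
  have [infI|/contrapT[l lP]] := pselect (infinite_type {q | lt q p}).
    have nI := infinite_embeds_nat infI; have sqI := embeds_square infI.
    apply: embeds_trans (ex_intro _ _ c_inj) _.
    have id_I : embeds {q | lt q p} {q | lt q p} by exists id.
    apply: (embeds_trans _ sqI); apply: embeds_pair id_I _.
    exact: embeds_trans (embeds_pair nI nI) sqI.
  exfalso; apply: infG.
  exists (List.flat_map (fun q => List.flat_map (fun a => List.map
    (fun b => gmul (ginv a) (gmul b (f q))) (keys (sval q))) (keys p)) l) => g.
  have [a [b [ia jb ab]]] := cP g; apply/List.in_flat_map; exists (c g).1; split=> //.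
  apply/List.in_flat_map; exists a; split; first exact: List.nth_error_In ia.
  apply/List.in_map_iff; exists b; split; last exact: List.nth_error_In jb.
  by rewrite -ab gmulKl.
pose phi g := `[< exists p a, List.In (a, true) p /\ g = gmul a (h p) >].
exists phi => w E; pose p := List.map (fun e => (e, w e)) E; exists (h p) => e eE.
have ep : List.In (e, w e) p by apply: (List.in_map (fun e => (e, w e))).
apply/idP/idP => [/asboolP[q [a [aq eq_ea]]]|we]; last first.
  by apply/asboolP; exists p, e; rewrite we in ep.
have kp : List.In e (keys p) by apply: (List.in_map fst) ep.
have kq : List.In a (keys q) by apply: (List.in_map fst) aq.
(* If [q] differs from [p], the translates of their keys meet, against the choice made for the later
   one. *)
have [ltqp|qp|ltpq] := lt_total q p.
- by case: (hP p (exist _ q ltqp) e a).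
- rewrite qp in aq eq_ea; move: eq_ea => /gmul_injr ea; rewrite -ea in aq.
  by move: aq => /List.in_map_iff[e' [[-> ->]]].
- by case: (hP q (exist _ p ltpq) a e).
Qed.

(** * The algebra of minimal functions *)

Local Open Scope R_scope.

Section MinimalFunctions.
Variable G : Group.
Implicit Types (phi psi : G -> R) (psis : list (G -> R)).

Lemma minimal_bounded psi : minimal_function psi -> bounded_fun psi.
Proof.
move=> [X [x0 [f [_ [cf psiE]]]]].
have [V []|x|l [lF lcov]] := @fcompact G X (fun V => fopen X V /\
    exists M, forall y, V y -> Rabs (f y) <= M); first by [].
  have [V [oV [Vx VP]]] := cf x 1 Rlt_0_1; exists V; split=> //; split=> //.
  exists (Rabs (f x) + 1) => y /VP; have := Rabs_triang (f y - f x) (f x).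
  by rewrite (_ : f y - f x + f x = f y); [lra | ring].
suff [M MP] : exists M, forall V y, List.In V l -> V y -> Rabs (f y) <= M.
  by exists M => g; rewrite psiE; have [V [Vl Vg]] := lcov (fact X g x0); apply: MP Vg.
elim: l lF {lcov} => [|V l IH] lF; first by exists 0.
have [V' V'l|M MP] := IH; first by apply: lF; right.
have [_ [M' M'P]] := lF V (or_introl erefl); exists (Rmax M M') => W y [<-|Wl] Wy.
  exact: Rle_trans (M'P _ Wy) (Rmax_r _ _).
exact: Rle_trans (MP _ _ Wl Wy) (Rmax_l _ _).
Qed.

(* Induction on [psis]: for [psi = f (_ x0)] the values [f (e x0)], [e] in [E], are built into
   the requirement, and [pattern_cover] brings an arbitrary translate back near [x0]. *)
Lemma minimal_values_free psis eta :
  infinite_group G -> (forall psi, List.In psi psis -> minimal_function psi) -> 0 < eta ->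
  forall chi : G -> bool,
  (forall (w : G -> bool) (E : list G), exists h, forall e, List.In e E -> chi (gmul e h) = w e) ->
  forall (delta : G -> list R -> bool) (E : list G), exists h, forall e, List.In e E ->
    exists s, Forall2 (fun psi t => Rabs (psi (gmul e h) - t) < eta) psis s /\
      delta e s = chi (gmul e h).
Proof.
move=> infG + eta_gt0 chi chiP; elim: psis => [_|psi psis IH min_psis] delta E.
  have [h hP] := chiP (fun e => delta e [::]) E.
  by exists h => e /hP->; exists [::].
have [|X [x0 [f [minX [cf psiE]]]]] := min_psis psi; first by left.
have /choice[V VP] e := cf (fact X e x0) eta eta_gt0.
pose U y := forall e, List.In e E -> V e (fact X e y).
have oU : fopen X U.
  by apply: fopen_forall => e _; apply: fact_cont; case: (VP e).
have Ux0 : U x0 by move=> e _; case: (VP e) => _ [].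
(* The symbols are functions [list R -> bool]: [delta e] with its first value fixed at
   [f (fact X e x0)]. *)
have [z [F zF]] := pattern_cover minX E (fun e s => delta e (f (fact X e x0) :: s)) infG oU Ux0.
(* [h0] must serve all [g] in [F] at once, as the [g] bringing [fact X h0 x0] into [U] depends on
   [h0]. *)
have [|h0 h0P] := IH _ z (List.flat_map (fun g => List.map (fun e => gmul e g) E) F).
  by move=> psi' psi'P; apply: min_psis; right.
have [g [gF Ug zg]] := zF (fact X h0 x0).
exists (gmul g h0) => e eE; have [|s [sP ds]] := h0P (gmul e g).
  by apply/List.in_flat_map; exists g; split=> //; apply: (List.in_map (fun e => gmul e g)).
exists (f (fact X e x0) :: s); rewrite -gmul_assoc in sP ds; split; last by rewrite -ds zg.
constructor=> //; rewrite psiE !fact_mul; case: (VP e) => _ [_]; apply; exact: Ug.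
Qed.

(** Boundedness and uniform continuity for the uniformity that the minimal functions induce on [G].
    These functions form a norm-closed algebra, hence bound [frakA] from above. *)
Definition minimally_uniform phi := bounded_fun phi /\ forall eps, 0 < eps ->
  exists psis eta, [/\ 0 < eta, forall psi, List.In psi psis -> minimal_function psi &
    forall g h, (forall psi, List.In psi psis -> Rabs (psi g - psi h) < eta) ->
      Rabs (phi g - phi h) < eps].

Lemma minimally_uniform2 phi1 phi2 eps1 eps2 : minimally_uniform phi1 -> minimally_uniform phi2 ->
  0 < eps1 -> 0 < eps2 ->
  exists psis eta, [/\ 0 < eta, forall psi, List.In psi psis -> minimal_function psi &
    forall g h, (forall psi, List.In psi psis -> Rabs (psi g - psi h) < eta) ->
      Rabs (phi1 g - phi1 h) < eps1 /\ Rabs (phi2 g - phi2 h) < eps2].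
Proof.
move=> [_ u1] [_ u2] /u1[psis1 [eta1 [eta1_gt0 min1 H1]]] /u2[psis2 [eta2 [eta2_gt0 min2 H2]]].
exists (psis1 ++ psis2)%list, (Rmin eta1 eta2); split; first exact: Rmin_glb_lt.
  by move=> psi /List.in_app_iff[/min1|/min2].
move=> g h gh; split; [apply: H1 | apply: H2] => psi psiP.
  by apply: Rlt_le_trans (gh psi _) (Rmin_l _ _); apply/List.in_app_iff; left.
by apply: Rlt_le_trans (gh psi _) (Rmin_r _ _); apply/List.in_app_iff; right.
Qed.

Lemma minimally_uniform_algebra : norm_closed_subalgebra minimally_uniform.
Proof.
split; first by move=> phi [].
split.
  move=> phi psi uphi upsi; split.
    case: uphi upsi => [[M MP] _] [[M' M'P] _]; exists (M + M') => g.
    by have := Rabs_triang (phi g) (psi g); have := MP g; have := M'P g; lra.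
  move=> eps eps_gt0.
  have [psis [eta [eta_gt0 minP H]]] := @minimally_uniform2 _ _ (eps / 2) (eps / 2) uphi upsi
    ltac:(lra) ltac:(lra).
  exists psis, eta; split=> // g h /H[H1 H2].
  have := Rabs_triang (phi g - phi h) (psi g - psi h).
  by rewrite (_ : phi g + psi g - (phi h + psi h) = phi g - phi h + (psi g - psi h)); [lra | ring].
split.
  move=> phi psi uphi upsi.
  have [[M MP] [M' M'P]] := (uphi.1, upsi.1).
  have M0 : 0 <= M by apply: Rle_trans (Rabs_pos _) (MP gone).
  have M'0 : 0 <= M' by apply: Rle_trans (Rabs_pos _) (M'P gone).
  split.
    by exists (M * M') => g; rewrite Rabs_mult; apply: Rmult_le_compat => //; apply: Rabs_pos.
  move=> eps eps_gt0; pose c := eps / (M + M' + 1).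
  have c_gt0 : 0 < c by apply: Rdiv_lt_0_compat; lra.
  have cE : c * (M + M' + 1) = eps by rewrite /c; field; lra.
  have [psis [eta [eta_gt0 minP H]]] := minimally_uniform2 uphi upsi c_gt0 c_gt0.
  exists psis, eta; split=> // g h /H[H1 H2].
  rewrite (_ : phi g * psi g - phi h * psi h =
    phi g * (psi g - psi h) + (phi g - phi h) * psi h); last by ring.
  apply: Rle_lt_trans (Rabs_triang _ _) _; rewrite !Rabs_mult.
  have := Rmult_le_compat _ _ _ _ (Rabs_pos _) (Rabs_pos _) (MP g) (Rlt_le _ _ H2).
  have := Rmult_le_compat _ _ _ _ (Rabs_pos _) (Rabs_pos _) (Rlt_le _ _ H1) (M'P h).
  by nra.
split.
  move=> c phi [[M MP] uphi]; split.
    exists (Rabs c * M) => g; rewrite Rabs_mult.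
    by apply: Rmult_le_compat_l (MP g); apply: Rabs_pos.
  move=> eps eps_gt0; have c0 := Rabs_pos c.
  have [|psis [eta [eta_gt0 minP H]]] := uphi (eps / (Rabs c + 1)).
    by apply: Rdiv_lt_0_compat; lra.
  exists psis, eta; split=> // g h /H/(Rmult_lt_compat_l (Rabs c + 1) _ _).
  rewrite -Rmult_minus_distr_l Rabs_mult.
  have -> : (Rabs c + 1) * (eps / (Rabs c + 1)) = eps by field; lra.
  by have := Rabs_pos (phi g - phi h); lra.
move=> phi approx; split.
  have [psi [[[M MP] _] psiP]] := approx 1 Rlt_0_1; exists (M + 1) => g.
  have := Rabs_triang (phi g - psi g) (psi g); have := MP g; have := psiP g.
  by rewrite (_ : phi g - psi g + psi g = phi g); [lra | ring].
move=> eps eps_gt0; have [|psi [[_ upsi] psiP]] := approx (eps / 4); first lra.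
have [|psis [eta [eta_gt0 minP H]]] := upsi (eps / 4); first lra.
exists psis, eta; split=> // g h /H; have := psiP g; have := psiP h.
have le_inv x a : Rabs x <= a -> - a <= x <= a by rewrite /Rabs; case: Rcase_abs => ? ?; lra.
by move=> /le_inv ? /le_inv ? /Rabs_def2 ?; apply: Rabs_def1; lra.
Qed.

Lemma minimal_minimally_uniform psi : minimal_function psi -> minimally_uniform psi.
Proof.
move=> min_psi; split; first exact: minimal_bounded.
move=> eps eps_gt0; exists [:: psi], eps; split=> // [psi' [<-|]|g h] //.
by apply; left.
Qed.

Lemma frakA_minimally_uniform phi : frakA G phi -> minimally_uniform phi.
Proof. exact: (fun A => A _ minimally_uniform_algebra minimal_minimally_uniform). Qed.

Lemma exists_not_frakA : infinite_group G -> exists phi : G -> R, bounded_fun phi /\ ~ frakA G phi.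
Proof.
move=> infG; have [chi chiP] := universal_function infG.
exists (fun g => if chi g then 1 else 0); split.
  by exists 1 => g; case: (chi g); rewrite ?Rabs_R0 ?Rabs_R1; lra.
move=> /frakA_minimally_uniform[_ /(_ 1 Rlt_0_1)[psis [eta [eta_gt0 minP near]]]].
(* Two values in {0,1} at distance less than 1 are equal. *)
have {}near g h : (forall psi, List.In psi psis -> Rabs (psi g - psi h) < eta) -> chi g = chi h.
  move=> /near; case: (chi g); case: (chi h) => //.
    by rewrite Rminus_0_r Rabs_R1; lra.
  by rewrite Rminus_0_l Rabs_Ropp Rabs_R1; lra.
(* Radius eta/2 puts any two elements close to the same [s] within eta of each other. *)
pose close (g : G) s := Forall2 (fun psi t => Rabs (psi g - t) < eta / 2) psis s.
have close_eq g h s : close g s -> close h s -> chi g = chi h.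
  move=> gs hs; apply: near; rewrite /close in gs hs.
  elim: gs hs => // psi t psis' s' gt _ IH hs; inversion hs; subst => psi' [<-|].
    have := Rabs_triang (psi g - t) (- (psi h - t)).
    by rewrite Rabs_Ropp (_ : psi g - t + - (psi h - t) = psi g - psi h); [lra | ring].
  exact: IH.
(* The opposite of the value of [chi] at any element close to [s]. *)
pose delta (_ : G) s := ~~ `[< exists g, close g s /\ chi g >].
have [|h hP] := @minimal_values_free psis (eta / 2) infG minP _ chi chiP delta [:: gone].
  by lra.
have [|s [hs]] := hP gone; first by left.
rewrite /delta; case: asboolP => [[g [gs chig]]|none] /= e.
  by rewrite -(close_eq _ _ _ gs hs) chig in e.
by apply: none; exists (gmul gone h); rewrite -e.
Qed.
End MinimalFunctions.

Theorem theorem1p1 (G : Group) (HG : infinite_group G) :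
  (forall X : Flow G, minimal_flow X ->
     disjoint_flows (bern_open G) (bern_act G) (fopen X) (fact X)) /\
  (exists phi : gcar G -> R, bounded_fun phi /\ ~ frakA G phi).
Proof.
split; first by move=> X; apply: bern_disjoint.
exact: exists_not_frakA.
Qed.
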